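(* Fix an iteration $k$ at which $m_k$ basis functions are used, and let $x^k\in L^2_\pi$ be the current iterate, determined by $\mathcal F_{k-1}$. Suppose the first $m_k$ basis coefficients of the gradient $\nabla f(x^k(\cdot),\cdot)$ are estimated by Monte Carlo integration with $M_k$ independent samples $(\theta_j,v_j)$, with $\theta_j\sim\pi$ and $v_j\sim\nu(\theta_j,\cdot)$, independent of $\mathcal F_{k-1}$, so that the error is $e_k=(e_{i,k})_{i=1}^{m_k}$ with $$e_{i,k}=\frac1{M_k}\sum_{j=1}^{M_k}\nabla F(x^k(\theta_j),\theta_j,v_j)B_i(\theta_j)-\int_\Theta\nabla f(x^k(\theta),\theta)B_i(\theta)\,\pi(d\theta).$$ Suppose there are constants $V\ge0$, $V_G\ge1$ such that, for all $\theta$ and all $x\in L^2_\pi$, $$\int |\nabla F(x(\theta),\theta,v)|^2\,\nu(\theta,dv)\le V+V_G\,|\nabla f(x(\theta),\theta)|^2 .$$ Let $Q_{m}=\sup_{\theta}\sum_{i=1}^{m}|B_i(\theta)|^2$. Then $$\mathbb E\big(\|e_k\|_2^2\,\big|\,\mathcal F_{k-1}\big)=\sum_{i=1}^{m_k}\mathbb E\big(|e_{i,k}|^2\,\big|\,\mathcal F_{k-1}\big)\le\frac{Q_{m_k}}{M_k}\Big(V_G\,\|\nabla f(x^k(\theta),\theta)\|_\pi^2+V\Big).$$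
   Context: Let $\pi$ be a probability measure on $\Theta\subset\mathbb R^d$ and $q\ge1$. $L^2_\pi$ is the space of functions $x:\Theta\to\mathbb R^q$ with $\|x\|_\pi^2=\int_\Theta|x(\theta)|^2\pi(d\theta)<\infty$. $(B_i)_{i\ge1}$ is a fixed orthonormal basis of the real-valued square-integrable functions with respect to $\pi$. For each $\theta$, $\nu(\theta,\cdot)$ is a probability measure for an uncertain variable $v$, and $f(x(\theta),\theta)=\int F(x(\theta),\theta,v)\,\nu(\theta,dv)$; $\nabla$ denotes the gradient in the first argument, and $\nabla F$ is an unbiased estimate of $\nabla f$: $\nabla f(x(\theta),\theta)=\int\nabla F(x(\theta),\theta,v)\,\nu(\theta,dv)$. It is assumed that $\nabla f(x(\cdot),\cdot)\in L^2_\pi$ for $x\in L^2_\pi$. $\mathcal F_{k-1}$ is the $\sigma$-algebra generated by all random variables used to estimate the gradient in the first $k-1$ iterations of the descent algorithm; $x^k$ is the iterate found after these $k-1$ iterations. *)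

(* Defs.v *)
From HB Require Import structures.
From mathcomp Require Import all_boot all_order all_algebra.
From mathcomp Require Import all_classical all_reals all_analysis.
From mathcomp Require Import measurable_realfun.

Set Implicit Arguments.
Unset Strict Implicit.
Unset Printing Implicit Defensive.

Import Order.TTheory GRing.Theory Num.Theory.
Import numFieldNormedType.Exports.

Local Open Scope classical_set_scope.
Local Open Scope ring_scope.

Definition rV_display : nat -> measure_display.
Proof. by move=> _; exact: default_measure_display. Qed.

(* The sigma-algebra on R^n generated by the coordinate maps, i.e. the Borel
   sigma-algebra; same construction as the library's one on n-tuples. *)
Section measurable_rV.
Context (R : realType) (n : nat).

Let coord (i : 'I_n) (x : 'rV[R]_n) : R := x ord0 i.

Let rV_set0 : g_sigma_preimage coord set0.
Proof. exact: sigma_algebra0. Qed.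

Let rV_setC A : g_sigma_preimage coord A -> g_sigma_preimage coord (~` A).
Proof. exact: sigma_algebraC. Qed.

Let rV_bigcup (A : (set 'rV[R]_n)^nat) :
  (forall i, g_sigma_preimage coord (A i)) ->
  g_sigma_preimage coord (\bigcup_i A i).
Proof. exact: sigma_algebra_bigcup. Qed.

HB.instance Definition _ := @isMeasurable.Build (rV_display n) 'rV[R]_n
  (g_sigma_preimage coord) rV_set0 rV_setC rV_bigcup.

End measurable_rV.

Definition subset_space (R : realType) (d : nat) (Theta : set 'rV[R]_d)
  (_ : Theta !=set0) : Type := set_type Theta.

Definition subset_display (R : realType) (d : nat) (Theta : set 'rV[R]_d) :
  Theta !=set0 -> measure_display.
Proof. by move=> _; exact: default_measure_display. Qed.

(* A subset of R^d with the trace of the Borel sigma-algebra. Nonemptiness is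
   only used because the library's measurable types are pointed. *)
Section measurable_subset_space.
Context (R : realType) (d : nat) (Theta : set 'rV[R]_d) (ne : Theta !=set0).
Local Notation T := (subset_space ne).

Definition subset_val (t : T) : 'rV[R]_d := val (t : set_type Theta).

HB.instance Definition _ := Choice.on T.
HB.instance Definition _ := isPointed.Build T
  (SigSub (mem_set (projT2 (cid ne))) : set_type Theta).

Let trace : set_system T :=
  preimage_set_system [set: T] subset_val (@measurable _ 'rV[R]_d).

Let trace_sigma_algebra : sigma_algebra [set: T] trace.
Proof. exact/sigma_algebra_preimage/sigma_algebra_measurable. Qed.

Let trace0 : trace set0.
Proof. by case: trace_sigma_algebra. Qed.

Let traceC A : trace A -> trace (~` A).
Proof. by case: trace_sigma_algebra => _ + _ tA => /(_ A tA); rewrite setTD. Qed.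

Let trace_bigcup (A : (set T)^nat) :
  (forall i, trace (A i)) -> trace (\bigcup_i A i).
Proof. by case: trace_sigma_algebra => _ _; exact. Qed.

HB.instance Definition _ := @isMeasurable.Build (subset_display ne) T
  trace trace0 traceC trace_bigcup.

End measurable_subset_space.

(* The library's norm `|A| on matrices is the sup norm; this is the Euclidean
   norm of the entries, used for vectors of R^q and for families of m vectors of
   R^q (the rows of an m x q matrix). *)
Definition norm2 (R : realType) (m n : nat) (A : 'M[R]_(m, n)) : R :=
  Num.sqrt (\sum_(i < m) \sum_(j < n) A i j ^+ 2).

Definition grad (R : realType) (q : nat) (g : 'rV[R]_q -> R) (y : 'rV[R]_q) :
  'rV[R]_q := \row_i 'D_(delta_mx ord0 i) g y.

Section L2.
Context (dT : measure_display) (T : measurableType dT) (R : realType).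
Variable pi : {measure set T -> \bar R}.

Definition L2sqnorm (q : nat) (x : T -> 'rV[R]_q) : \bar R :=
  (\int[pi]_t ((norm2 (x t)) ^+ 2)%:E)%E.

Definition L2 (q : nat) : set (T -> 'rV[R]_q) :=
  [set x | measurable_fun setT x /\ (L2sqnorm x < +oo)%E].

Definition vintegral (q : nat) (g : T -> 'rV[R]_q) : 'rV[R]_q :=
  \row_i \int[pi]_t (g t ord0 i).

(* B i stands for the basis function of index i + 1. *)
Definition orthonormal_basis (B : nat -> T -> R) : Prop :=
  [/\ forall i, B i \in Lfun pi 2%:E,
      forall i j, \int[pi]_t (B i t * B j t) = (i == j)%:R
    & forall g : T -> R, g \in Lfun pi 2%:E ->
        Lnorm pi 2%:E (fun t =>
          (g t - \sum_(i < n) (\int[pi]_s (g s * B i s)) * B i t)%:E)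
          @[n --> \oo] --> 0%E].

Definition supsq (B : nat -> T -> R) (m : nat) : \bar R :=
  ereal_sup (range (fun t => (\sum_(i < m) `|B i t| ^+ 2)%:E)).

End L2.

Section laws.
Context (dO : measure_display) (Omega : measurableType dO) (R : realType).
Variable P : probability Omega R.

Definition has_law (dT : measure_display) (T : measurableType dT)
    (X : Omega -> T) (mu : {measure set T -> \bar R}) : Prop :=
  forall A, measurable A -> P (X @^-1` A) = mu A.

(* The conditional law of Y given X = t is kappa t. *)
Definition has_cond_law (dT dV : measure_display) (T : measurableType dT)
    (V : measurableType dV) (X : Omega -> T) (Y : Omega -> V)
    (kappa : T -> {measure set V -> \bar R}) : Prop :=
  forall A C, measurable A -> measurable C ->
    P (X @^-1` A `&` Y @^-1` C) = (\int[P]_(w in X @^-1` A) kappa (X w) C)%E.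

Definition mutually_independent (dT : measure_display) (T : measurableType dT)
    (M : nat) (Z : 'I_M -> Omega -> T) : Prop :=
  forall (J : {set 'I_M}) (A : 'I_M -> set T), (forall j, measurable (A j)) ->
    P (\bigcap_(j in [set j | j \in J]) Z j @^-1` A j) =
    (\prod_(j in J) P (Z j @^-1` A j))%E.

Definition sigma_independent (G H : set_system Omega) : Prop :=
  forall A B, <<s G >> A -> <<s H >> B -> P (A `&` B) = (P A * P B)%E.

(* Y is a version of E(X | <<s G >>) for a nonnegative, possibly
   non-integrable, random variable X. When X is measurable and <<s G >> consists
   of measurable sets, a version exists (Radon-Nikodym applied to the truncations
   of X) and is unique P-a.e., so the default value in condexp plays no role. *)
Definition is_condexp (G : set_system Omega) (X Y : Omega -> \bar R) : Prop :=
  [/\ measurable_fun setT (Y : g_sigma_algebraType G -> \bar R),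
      forall w, (0 <= Y w)%E
    & forall A, <<s G >> A ->
        (\int[P]_(w in A) Y w = \int[P]_(w in A) X w)%E].

Definition condexp (G : set_system Omega) (X : Omega -> \bar R) :
    Omega -> \bar R :=
  xget (cst 0%E) (is_condexp G X).

(* Generators of the sigma-algebra of the first n iterations, where xi l
   gathers all the random variables used in iteration l >= 1. *)
Definition history (dU : nat -> measure_display)
    (U : forall l, measurableType (dU l)) (xi : forall l, Omega -> U l)
    (n : nat) : set_system Omega :=
  \bigcup_(l in [set l | (0 < l <= n)%N])
    preimage_set_system setT (xi l) measurable.

End laws.

Section problem.
Context (dT dV : measure_display) (T : measurableType dT)
  (V : measurableType dV) (R : realType) (q : nat).
Variables (nu : R.-pker T ~> V) (F : 'rV[R]_q -> T -> V -> R).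

Definition mean_obj (y : 'rV[R]_q) (t : T) : R := \int[nu t]_v F y t v.

Definition grad_f (y : 'rV[R]_q) (t : T) : 'rV[R]_q :=
  grad (fun z => mean_obj z t) y.

Definition grad_F (y : 'rV[R]_q) (t : T) (v : V) : 'rV[R]_q :=
  grad (fun z => F z t v) y.

Definition mc_error (pi : {measure set T -> \bar R}) (B : nat -> T -> R)
    (m M : nat) (x : T -> 'rV[R]_q) (theta : 'I_M -> T) (v : 'I_M -> V) :
    'M[R]_(m, q) :=
  \matrix_(i < m)
    (M%:R^-1 *:
       \sum_(j < M) (B i (theta j) *: grad_F (x (theta j)) (theta j) (v j))
     - vintegral pi (fun t => B i t *: grad_f (x t) t)).

End problem.

(* Main.v *)
(** The samples are independent of the past, so conditioning on it amounts to
    freezing the iterate: w |-> E |e(x^k(w), Z)|^2 is a version of the conditional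
    expectation, and versions are almost surely unique. For a frozen x each
    component of the error is the centred mean of M i.i.d. variables Y, hence its
    second moment is Var(Y) / M <= E(Y^2) / M; this also holds, trivially, when
    E(Y^2) is infinite. Disintegrating the law of (theta, v) and summing over the
    components turns E(Y^2) into the integral of sum_i |B_i|^2 times the
    conditional second moment of the gradient estimate. With 0 * oo = 0 the bound
    by Q_m persists when Q_m is infinite. *)
Require Import Defs.
From HB Require Import structures.
From mathcomp Require Import all_boot all_order all_algebra.
From mathcomp Require Import all_classical all_reals all_analysis.
From mathcomp Require Import measurable_realfun ring lra.

Import Order.TTheory GRing.Theory Num.Theory.
Import numFieldNormedType.Exports.

Local Open Scope classical_set_scope.
Local Open Scope ring_scope.

(** * Integration of functions of two independent random elements *)

Section independent_pair.
Context (dO d1 d2 : measure_display) (Omega : measurableType dO)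
  (S1 : measurableType d1) (S2 : measurableType d2) (R : realType).
Variables (P : probability Omega R) (X : {RV P >-> S1}) (Y : {RV P >-> S2}).
Hypothesis XY : forall A B, measurable A -> measurable B ->
  P (X @^-1` A `&` Y @^-1` B) = (P (X @^-1` A) * P (Y @^-1` B))%E.
Local Open Scope ereal_scope.

Let mXY : measurable_fun setT (fun w => (X w, Y w)).
Proof. exact: measurable_fun_pair. Qed.

Let joint_law (C : set (S1 * S2)) : measurable C ->
  (distribution P X \x distribution P Y) C =
  pushforward P (fun w => (X w, Y w)) C.
Proof. by move=> mC; apply: product_measure_unique => // A B mA mB; exact: XY. Qed.

(** By [joint_law] the pair is distributed as the product of its marginals; Tonelli and a change of
    variables in each marginal then turn the integral into one over two separate copies of [P]. *)
Lemma independent_integral (phi : S1 * S2 -> \bar R) :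
  measurable_fun setT phi -> (forall z, 0 <= phi z) ->
  \int[P]_w phi (X w, Y w) = \int[P]_w \int[P]_w' phi (X w, Y w').
Proof.
move=> mphi phi0.
transitivity (\int[pushforward P (fun w => (X w, Y w))]_z phi z).
  by rewrite ge0_integral_pushforward.
rewrite (eq_measure_integral (distribution P X \x distribution P Y)); last first.
  by move=> C mC _; apply/esym; exact: joint_law.
rewrite fubini_tonelli1// ge0_integral_pushforward//; last 2 first.
- exact: measurable_fun_fubini_tonelli_F.
- by move=> y _; apply: integral_ge0.
apply: eq_integral => w _ /=.
rewrite /fubini_F ge0_integral_pushforward//.
exact: measurableT_comp.
Qed.

(** Fubini on the product law; Tonelli for the absolute values provides the integrability of the
    product. This is what annihilates the cross terms of a variance. *)
Lemma independent_expectationM (f : S1 -> R) (g : S2 -> R) :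
  measurable_fun setT f -> measurable_fun setT g ->
  P.-integrable setT (fun w => (f (X w))%:E) ->
  P.-integrable setT (fun w => (g (Y w))%:E) ->
  \int[P]_w (f (X w) * g (Y w))%:E =
  (\int[P]_w (f (X w))%:E) * (\int[P]_w (g (Y w))%:E).
Proof.
move=> mf mg fi gi.
pose phi (z : S1 * S2) := (f z.1 * g z.2)%:E : \bar R.
have mphi : measurable_fun setT phi.
  apply/measurable_EFinP; apply: measurable_funM; exact: measurableT_comp.
have mf' : measurable_fun setT (EFin \o f) by exact/measurable_EFinP.
have mg' : measurable_fun setT (EFin \o g) by exact/measurable_EFinP.
have fX : (distribution P X).-integrable setT (EFin \o f).
  exact: integrable_pushforward.
have gY : (distribution P Y).-integrable setT (EFin \o g).
  exact: integrable_pushforward.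
have phii : (distribution P X \x distribution P Y).-integrable setT phi.
  apply/integrable12ltyP => //.
  under eq_integral.
    move=> x _; under eq_integral do rewrite /phi/= normrM EFinM.
    rewrite ge0_integralZl//; last first.
      by apply/measurable_EFinP; exact: measurableT_comp.
    over.
  rewrite ge0_integralZr//; last 2 first.
  - by apply/measurable_EFinP; exact: measurableT_comp.
  - exact: integral_ge0.
  move/integrableP : fX => [_ fX]; move/integrableP : gY => [_ gY].
  by apply: lte_mul_pinfty => //; rewrite ?ge0_fin_numE//; exact: integral_ge0.
transitivity (\int[pushforward P (fun w => (X w, Y w))]_z phi z).
  rewrite integral_pushforward//.
  apply/integrableP; split; first exact: measurableT_comp.
  have := phii => /integrableP[_].
  rewrite (eq_measure_integral (pushforward P (fun w => (X w, Y w)))); last first.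
    by move=> C mC _; exact: joint_law.
  rewrite ge0_integral_pushforward//; exact: measurableT_comp.
rewrite (eq_measure_integral (distribution P X \x distribution P Y)); last first.
  by move=> C mC _; apply/esym; exact: joint_law.
rewrite -integral12_prod_meas1//.
have -> : \int[P]_w (f (X w))%:E = \int[distribution P X]_x (EFin \o f) x.
  by rewrite integral_pushforward.
have -> : \int[P]_w (g (Y w))%:E = \int[distribution P Y]_y (EFin \o g) y.
  by rewrite integral_pushforward.
rewrite -(fineK (integrable_fin_num _ gY))// -integralZr//.
apply: eq_integral => x _; rewrite /fubini_F/phi/=.
by under eq_integral do rewrite EFinM; rewrite integralZl// fineK// integrable_fin_num.
Qed.

End independent_pair.

(** * Disintegration of a joint law *)

Section conditional_law.
Context (dO dT dV : measure_display) (Omega : measurableType dO)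
  (T : measurableType dT) (V : measurableType dV) (R : realType).
Variables (P : probability Omega R) (X : {RV P >-> T}) (Y : {RV P >-> V})
  (pi : probability T R) (nu : R.-pker T ~> V).
Hypotheses (Xpi : has_law P X pi) (Ynu : has_cond_law P X Y nu).
Local Open Scope ereal_scope.

(** Composing [pi] with [nu] gives a measure on [T * V] that agrees with the law of [(X, Y)] on
    measurable rectangles. These generate the product sigma-algebra and are closed under
    intersection, so the two measures coincide. *)
Lemma cond_law_integral (phi : T * V -> \bar R) :
  measurable_fun setT phi -> (forall z, 0 <= phi z) ->
  \int[P]_w phi (X w, Y w) = \int[pi]_t \int[nu t]_v phi (t, v).
Proof.
move=> mphi phi0.
have mXY : measurable_fun setT (fun w => (X w, Y w)) by exact: measurable_fun_pair.
have Xpi' f : measurable_fun setT f -> (forall t, 0 <= f t) ->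
    forall A, measurable A -> \int[P]_(w in X @^-1` A) f (X w) = \int[pi]_(t in A) f t.
  move=> mf f0 A mA.
  transitivity (\int[distribution P X]_(t in A) f t).
    by rewrite ge0_integral_pushforward//; exact: measurable_funTS.
  by apply: eq_measure_integral => B mB _; exact: Xpi.
(* Kernel composition hands both the source and the intermediate point to the second kernel. A Dirac
   kernel at [(t, v)] thus retains [t], and [k] maps [t] to the law of [(t, v)] with [v] drawn from
   [nu t]. The type [unit] is the source of the constant kernel [l]. *)
have msel : measurable_fun setT (fun p : unit * T * V => (p.1.2, p.2)).
  apply: measurable_fun_pair => //.
  exact: measurableT_comp measurable_snd measurable_fst.
pose k : R.-sfker (unit * T)%type ~> (T * V)%type :=
  kernel.kernel_snd nu \; kdirac msel.
pose l : R.-sfker unit ~> T :=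
  kprobability (@measurable_cst _ _ unit (pprobability T R) setT pi).
have kE t f : measurable_fun setT f -> (forall z, 0 <= f z) ->
    \int[k (tt, t)]_z f z = \int[nu t]_v f (t, v).
  move=> mf f0; rewrite /k integral_kcomp//; apply: eq_integral => v _.
  by rewrite integral_dirac// diracT mul1e.
have lkE f : measurable_fun setT f -> (forall z, 0 <= f z) ->
    \int[mkcomp l k tt]_z f z = \int[pi]_t \int[nu t]_v f (t, v).
  by move=> mf f0; rewrite integral_kcomp//; apply: eq_integral => t _; exact: kE.
have rect A C : measurable A -> measurable C ->
    P (X @^-1` A `&` Y @^-1` C) = mkcomp l k tt (A `*` C).
  move=> mA mC; rewrite Ynu// (Xpi' (nu ^~ C))//; last exact: measurable_kernel.
  have mAC : measurable (A `*` C) by exact: measurableX.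
  transitivity (\int[mkcomp l k tt]_z (\1_(A `*` C) z)%:E); last first.
    by rewrite integral_indic// setIT.
  rewrite (lkE (fun z => (\1_(A `*` C) z)%:E))//; last first.
    exact/measurable_EFinP/measurable_indic.
  rewrite integral_mkcond; apply: eq_integral => t _.
  rewrite patchE; case: ifPn => [tA|tA].
    rewrite -[C in LHS]setIT -integral_indic//; apply: eq_integral => v _.
    by congr (_%:E); rewrite !indicE in_setX tA.
  rewrite integral0_eq// => v _.
  by rewrite indicE in_setX (negbTE tA).
transitivity (\int[pushforward P (fun w => (X w, Y w))]_z phi z).
  by rewrite ge0_integral_pushforward.
rewrite -(lkE phi)//.
apply: eq_measure_integral => B mB _.
pose G : set (set (T * V)) :=
  [set D | exists A, measurable A /\ exists C, measurable C /\ D = A `*` C].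
apply: (measure_unique G (fun=> setT)) => //.
- rewrite measurable_prod_measurableType; congr (<<s _ >>).
  apply/seteqP; split => [_ [A mA [C mC <-]]|_ [A [mA [C [mC ->]]]]].
    by exists A; split => //; exists C.
  by exists A => //; exists C.
- move=> _ _ [A1 [mA1 [C1 [mC1 ->]]]] [A2 [mA2 [C2 [mC2 ->]]]].
  rewrite -setXI; exists (A1 `&` A2); split; first exact: measurableI.
  by exists (C1 `&` C2); split => //; exact: measurableI.
- by move=> _; exists setT; split => //; exists setT; rewrite setXTT.
- by rewrite bigcup_const.
- by move=> _ [A [mA [C [mC ->]]]]; exact: rect.
- by move=> _; rewrite -ge0_fin_numE// fin_num_measure//; exact: measurableT.
Qed.

End conditional_law.

(** * Conditional expectation given a generated sub-sigma-algebra *)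

Section generated_sub_sigma_algebra.
Context (dO : measure_display) (Omega : measurableType dO) (R : realType).
Variables (P : probability Omega R) (G : set_system Omega).
Hypothesis Gm : G `<=` measurable.

Lemma measurable_gen (A : set Omega) : <<s G >> A -> measurable A.
Proof. exact: smallest_sub (sigma_algebra_measurable _) Gm A. Qed.

Lemma measurable_id_gen :
  measurable_fun setT (id : Omega -> g_sigma_algebraType G).
Proof. by move=> _ A mA; rewrite setTI; exact: measurable_gen. Qed.

(** The identity as a random element with values in [Omega] under the coarser sigma-algebra: its
    distribution is the restriction of [P] to [<<s G >>]. *)
Definition id_gen : {mfun Omega >-> g_sigma_algebraType G} :=
  MeasurableFun.Pack (MeasurableFun.Class
    (isMeasurableFun.Build _ _ _ _ _ measurable_id_gen)).

Lemma measurable_fun_gen (d : measure_display) (S : measurableType d)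
    (f : g_sigma_algebraType G -> S) :
  measurable_fun setT f -> measurable_fun setT (f : Omega -> S).
Proof. by move=> mf; exact: measurableT_comp mf measurable_id_gen. Qed.

Local Open Scope ereal_scope.

Lemma integral_gen (A : set Omega) (f : g_sigma_algebraType G -> \bar R) :
  <<s G >> A -> measurable_fun setT f -> (forall w, 0 <= f w) ->
  \int[distribution P id_gen]_(w in A) f w = \int[P]_(w in A) f w.
Proof.
move=> mA mf f0; rewrite ge0_integral_pushforward//.
exact: measurable_funTS.
Qed.

(** Versions may be non-integrable or infinite, so uniqueness for integrable functions is applied on
    each set where one version is at most [n]. These sets exhaust the points where that version is
    finite; where both are infinite they agree anyway. *)
Lemma condexp_unique (X Y1 Y2 : Omega -> \bar R) :
  is_condexp P G X Y1 -> is_condexp P G X Y2 -> {ae P, forall w, Y1 w = Y2 w}.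
Proof.
have half Z1 Z2 : is_condexp P G X Z1 -> is_condexp P G X Z2 ->
    forall n : nat, {ae P, forall w, Z1 w <= n%:R%:E -> Z1 w = Z2 w}.
  move=> [mZ1 Z10 Z1E] [mZ2 Z20 Z2E] n.
  pose D : set (g_sigma_algebraType G) := [set w | Z1 w <= n%:R%:E].
  have mD : measurable D.
    by rewrite -[D]setTI; exact: emeasurable_fun_infty_c.
  have : ae_eq (distribution P id_gen) D Z1 Z2.
    apply: integral_ae_eq => //; last 2 first.
    - exact: measurable_funTS.
    - move=> E ED mE.
      rewrite (integral_gen _ Z1)// (integral_gen _ Z2)//.
      by rewrite Z1E// Z2E.
    apply/integrableP; split; first exact: measurable_funTS.
    under eq_integral do rewrite gee0_abs//.
    apply: (@le_lt_trans _ _ (\int[distribution P id_gen]_(w in D) (n%:R%:E))).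
      by apply: ge0_le_integral => //; exact: measurable_funTS.
    rewrite integral_cst//; apply: lte_mul_pinfty => //.
    by rewrite -ge0_fin_numE// fin_num_measure.
  move=> [N [mN N0 DN]]; exists N; split => //.
  exact: measurable_gen.
move=> c1 c2.
have : {ae P, forall w, forall n : nat,
    (Y1 w <= n%:R%:E -> Y1 w = Y2 w) /\ (Y2 w <= n%:R%:E -> Y2 w = Y1 w)}.
  apply/ae_foralln => n.
  by apply: filterS2 (half _ _ c1 c2 n) (half _ _ c2 c1 n).
apply: filterS => w h.
have [_ Y10 _] := c1; have [_ Y20 _] := c2.
have ub (r : R) : exists n : nat, r%:E <= n%:R%:E :> \bar R.
  by exists (Num.truncn r).+1; rewrite lee_fin ltW// truncnS_gt.
move: (Y10 w) (Y20 w) h; case: (Y1 w) => [r| |//] _; case: (Y2 w) => [s| |//] _ h //.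
- by have [n /(h n).1] := ub r.
- by have [n /(h n).1] := ub r.
- by have [n /(h n).2 ->] := ub s.
Qed.

(** [xget] returns a version as soon as one exists, and [Y] witnesses existence. *)
Lemma condexp_ae (X Y : Omega -> \bar R) :
  is_condexp P G X Y -> {ae P, forall w, condexp P G X w = Y w}.
Proof.
move=> XY; apply: condexp_unique (XY).
by rewrite /condexp; apply: xgetPex; exists Y.
Qed.

End generated_sub_sigma_algebra.

(* Freezing lemma. It exhibits a version of the conditional expectation, so that
   no Radon-Nikodym argument is needed for the existence hidden in condexp. *)
Lemma is_condexp_independent (dO : measure_display) (Omega : measurableType dO)
    (R : realType) (P : probability Omega R) (G H : set_system Omega)
    (phi : g_sigma_algebraType G * g_sigma_algebraType H -> \bar R) :
  G `<=` measurable -> H `<=` measurable -> sigma_independent P G H ->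
  measurable_fun setT phi -> (forall z, 0 <= phi z)%E ->
  is_condexp P G (fun w => phi (w, w)) (fun w => \int[P]_w' phi (w, w'))%E.
Proof.
move=> Gm Hm GH mphi phi0; split.
(* Tonelli for the restriction of [P] to [<<s H >>] gives measurability with respect to [<<s G >>]
   itself, not merely to the sigma-algebra of [Omega]. *)
- rewrite (_ : (fun w => _) = fubini_F (distribution P (id_gen _ _ _ Hm)) phi).
    exact: measurable_fun_fubini_tonelli_F.
  apply/funext => w; rewrite /fubini_F ge0_integral_pushforward//.
  exact: measurableT_comp.
- by move=> w; exact: integral_ge0.
- move=> A mA.
  pose X := id_gen _ _ _ Gm : {RV P >-> _}; pose Y := id_gen _ _ _ Hm : {RV P >-> _}.
  (* The indicator of [A] is a function of the first variable, so it can be absorbed into the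
     integrand before independence decouples the diagonal [(w, w)] into [(w, w')]. *)
  pose psi (z : g_sigma_algebraType G * g_sigma_algebraType H) :=
    ((\1_(A : set (g_sigma_algebraType G)) z.1)%:E * phi z)%E.
  have mpsi : measurable_fun setT psi.
    apply: emeasurable_funM => //; apply/measurable_EFinP.
    apply: measurableT_comp => //; exact: measurable_indic.
  have psi0 z : (0 <= psi z)%E by rewrite mule_ge0// lee_fin.
  have AE (f : Omega -> \bar R) : (\int[P]_(w in A) f w = \int[P]_w ((\1_A w)%:E * f w))%E.
    by rewrite integral_mkcond; apply: eq_integral => w _; rewrite epatch_indic muleC.
  rewrite !AE -[RHS]/(\int[P]_w psi (X w, Y w))%E.
  rewrite independent_integral//.
  apply: eq_integral => w _; rewrite /psi/=.
  rewrite ge0_integralZl//; apply: (measurable_fun_gen _ _ _ Hm).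
  exact: measurableT_comp.
Qed.

(** * Measurability of vector-valued maps, parametric integrals and gradients *)

Section measurable_rV.
Context (R : realType) (n : nat) (d : measure_display) (S : measurableType d).

Lemma measurable_coord (i : 'I_n) :
  measurable_fun setT (fun y : 'rV[R]_n => y ord0 i).
Proof.
move=> _ Y mY; rewrite setTI; apply: sub_sigma_algebra => /=.
rewrite -bigcup_seq/=; exists i => /=; first by rewrite mem_index_enum.
by exists Y => //; rewrite setTI.
Qed.

Lemma measurable_fun_rVP (f : S -> 'rV[R]_n) :
  measurable_fun setT f <->
  forall i, measurable_fun setT (fun s => f s ord0 i).
Proof.
split=> [mf i|mf]; first exact: measurableT_comp (measurable_coord i) mf.
apply: (measurability (\big[setU/set0]_(i < n)
  preimage_set_system setT (fun y : 'rV[R]_n => y ord0 i) measurable)) => //.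
move=> _ [B + <-]; rewrite -bigcup_seq => -[i _ [C mC <-]].
by rewrite !setTI; have := mf i measurableT _ mC; rewrite setTI.
Qed.
End measurable_rV.

(** Carries identities known for nonnegative functions on [T] over to signed ones, through a map
    [h]. *)
Lemma integralE_comp (R : realType) (d : measure_display) (S : measurableType d)
    (T : Type) (m : {measure set S -> \bar R}) (h : S -> T) (f : T -> \bar R) :
  (\int[m]_s f (h s) = \int[m]_s f^\+ (h s) - \int[m]_s f^\- (h s))%E.
Proof.
by rewrite integralE; congr (_ - _)%E;
  apply: eq_integral => s _; rewrite ?funeposE ?funenegE.
Qed.

Section measurable_parametric_integral.
Context (R : realType) (d1 d2 : measure_display) (X : measurableType d1)
  (Y : measurableType d2).

Lemma measurable_Rintegral_kernel (l : R.-fker X ~> Y) (f : X * Y -> R) :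
  measurable_fun setT f ->
  measurable_fun setT (fun x => \int[l x]_y f (x, y)).
Proof.
move=> mf; apply: measurableT_comp => //.
have mf' : measurable_fun setT (EFin \o f) by exact/measurable_EFinP.
rewrite [X in measurable_fun _ X](_ : _ = (fun x =>
    \int[l x]_y ((EFin \o f)^\+ (x, y)) - \int[l x]_y ((EFin \o f)^\- (x, y)))%E).
  apply: emeasurable_funB.
    apply: (measurable_fun_integral_finite_kernel _ l) => //.
    exact: measurable_funepos.
  apply: (measurable_fun_integral_finite_kernel _ l) => //.
  exact: measurable_funeneg.
by apply/funext => x; exact: (integralE_comp _ _ _ _ _ (pair x) (EFin \o f)).
Qed.

End measurable_parametric_integral.

(** A partial derivative is the pointwise limit of difference quotients with steps [1/(n+1)], each
    jointly measurable in the point and the parameter; differentiability makes the limit exist. *)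
Lemma measurable_grad (R : realType) (q : nat) (d : measure_display)
    (S : measurableType d) (g : 'rV[R]_q -> S -> R) (i : 'I_q) :
  measurable_fun setT (fun p : 'rV[R]_q * S => g p.1 p.2) ->
  (forall (y : 'rV[R]_q) s, differentiable (g ^~ s) y) ->
  measurable_fun setT (fun p : 'rV[R]_q * S => grad (g ^~ p.2) p.1 ord0 i).
Proof.
move=> mg dg; pose u (n : nat) : R := n.+1%:R^-1.
pose q_ n (p : 'rV[R]_q * S) : R :=
  (u n)^-1 * (g (u n *: delta_mx ord0 i + p.1) p.2 - g p.1 p.2).
have mcoord (f : 'rV[R]_q * S -> 'rV[R]_q) : measurable_fun setT f ->
    measurable_fun setT (fun p => g (f p) p.2).
  by move=> mf; apply: (measurableT_comp mg (measurable_fun_pair mf _)).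
apply: (measurable_fun_cvg (h := q_)) => [n|p _].
  apply: measurable_funM => //; apply: measurable_funB; apply: mcoord => //.
  apply/measurable_fun_rVP => j.
  rewrite [X in measurable_fun _ X](_ : _ = fun p : 'rV[R]_q * S =>
      (u n *: delta_mx ord0 i : 'rV[R]_q) ord0 j + p.1 ord0 j); last first.
    by apply/funext => p; rewrite mxE.
  apply: measurable_funD => //.
  exact: measurableT_comp (measurable_coord _ _ j) measurable_fst.
rewrite /grad mxE /derive.
have /cvg_ex[l lP] : derivable (g ^~ p.2) p.1 (delta_mx ord0 i).
  exact: diff_derivable.
rewrite (cvg_lim _ lP)//.
(* The derivative is a limit over punctured neighbourhoods of 0, and the steps are never zero. *)
have u0 : u n @[n --> \oo] --> 0^'.
  move=> A A0.
  have : \forall n \near \oo, u n != 0 -> A (u n) := @cvg_harmonic R _ A0.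
  by apply: filterS => n; apply; rewrite /u invr_eq0 pnatr_eq0.
exact: cvg_comp u0 lP.
Qed.

(** * Square-integrable functions *)

Section square_integrable.
Context (d : measure_display) (T : measurableType d) (R : realType).
Variable mu : {measure set T -> \bar R}.
Local Open Scope ereal_scope.

Lemma integrable_sqr (f : T -> R) : measurable_fun setT f ->
  \int[mu]_t (f t ^+ 2)%:E < +oo ->
  mu.-integrable setT (fun t => (f t ^+ 2)%:E).
Proof.
move=> mf foo; apply/integrableP; split.
  by apply/measurable_EFinP; exact: measurable_funX.
by under eq_integral do rewrite /= ger0_norm ?sqr_ge0//.
Qed.

(** Domination by [|f g| <= f^2 + g^2]. *)
Lemma integrableM_sqr (f g : T -> R) :
  measurable_fun setT f -> measurable_fun setT g ->
  mu.-integrable setT (fun t => (f t ^+ 2)%:E) ->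
  mu.-integrable setT (fun t => (g t ^+ 2)%:E) ->
  mu.-integrable setT (fun t => (f t * g t)%:E).
Proof.
move=> mf mg fi gi.
apply: le_integrable (integrableD measurableT fi gi) => //.
  by apply/measurable_EFinP; exact: measurable_funM.
move=> t _; rewrite -EFinD !abse_EFin lee_fin normrM.
rewrite (@ger0_norm _ (_ + _)%R) ?addr_ge0 ?sqr_ge0//.
rewrite -(@real_normK _ (f t)) ?num_real// -(@real_normK _ (g t)) ?num_real//.
set a := (`|f t|)%R; set b := (`|g t|)%R.
have := normr_ge0 (f t); have := normr_ge0 (g t); rewrite -/a -/b => a0 b0.
nra.
Qed.

End square_integrable.

(** * Mean squared error of a sample mean *)

Section sample_mean.
Context (d : measure_display) (Omega : measurableType d) (R : realType).
Variables (P : probability Omega R) (M : nat) (X : 'I_M -> Omega -> R) (mu : R).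
Hypotheses (M0 : (0 < M)%N) (mX : forall j, measurable_fun setT (X j))
  (iX : forall j, P.-integrable setT (fun w => (X j w)%:E))
  (muX : forall j, (\int[P]_w (X j w)%:E = mu%:E)%E)
  (uncorrelated : forall j l, j != l ->
    (\int[P]_w ((X j w - mu) * (X l w - mu))%:E = 0)%E).
Local Open Scope ereal_scope.

(** Expanding the square leaves only the [M] diagonal terms. Each is a variance, hence at most the
    second moment, and the factor [1/M^2] times [M] terms gives [1/M]. *)
Lemma sample_mean_sqerror_le (s : \bar R) :
  (forall j, \int[P]_w (X j w ^+ 2)%:E <= s) ->
  \int[P]_w ((M%:R^-1 * \sum_(j < M) X j w - mu) ^+ 2)%:E <= (M%:R^-1)%:E * s.
Proof.
have Mp : (0 < M%:R^-1 :> R)%R by rewrite invr_gt0 ltr0n.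
(* For [s = +oo] the right-hand side is infinite because [1/M > 0]; [s = -oo] cannot bound a
   nonnegative integral. *)
case: s => [s| |] hs; last 2 first.
- by rewrite gt0_muley ?lte_fin// leey.
- have := hs (Ordinal M0); rewrite leeNy_eq => /eqP h.
  have : 0 <= \int[P]_w (X (Ordinal M0) w ^+ 2)%:E.
    by apply: integral_ge0 => w _; rewrite lee_fin sqr_ge0.
  by rewrite h.
have X2 j : P.-integrable setT (fun w => (X j w ^+ 2)%:E).
  by apply: integrable_sqr => //; apply: le_lt_trans (hs j) _; rewrite ltry.
have ilin j (a b : R) : P.-integrable setT (fun w => (a * X j w + b)%:E).
  under eq_fun do rewrite EFinD EFinM.
  apply: integrableD => //; first exact: integrableZl.
  exact: finite_measure_integrable_cst.
have mD j : measurable_fun setT (fun w => X j w - mu)%R.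
  exact: measurable_funB.
have D2 j : P.-integrable setT (fun w => ((X j w - mu) ^+ 2)%:E).
  rewrite (_ : (fun w => _) =
      (fun w => (X j w ^+ 2)%:E + (- (2 * mu) * X j w + mu ^+ 2)%:E)).
    exact: integrableD.
  by apply/funext => w; rewrite -EFinD; congr (_%:E); ring.
have D2le j : \int[P]_w ((X j w - mu) ^+ 2)%:E <= s%:E.
  apply: le_trans (hs j).
  (* [X^2 = (X - mu)^2 + (2 mu X - mu^2)], and the last bracket has expectation [mu^2 >= 0]. *)
  rewrite [leRHS](_ : _ = \int[P]_w (((X j w - mu) ^+ 2)%:E +
      (2 * mu * X j w + - mu ^+ 2)%:E)); last first.
    by apply: eq_integral => w _; rewrite -EFinD; congr (_%:E); ring.
  rewrite integralD//= leeDl//.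
  under eq_integral do rewrite EFinD EFinM.
  rewrite integralD//=; last 2 first.
  - exact: integrableZl.
  - exact: finite_measure_integrable_cst.
  rewrite integralZl// muX integral_cst//.
  rewrite [X in _ + _ * X](_ : _ = 1); last exact: probability_setT.
  rewrite mule1 -EFinM -EFinD.
  by rewrite lee_fin (_ : _ + _ = mu ^+ 2)%R ?sqr_ge0//; ring.
have DD j l : P.-integrable setT (fun w => ((X j w - mu) * (X l w - mu))%:E).
  exact: integrableM_sqr.
have expand w : ((M%:R^-1 * \sum_(j < M) X j w - mu) ^+ 2 =
    M%:R^-1 ^+ 2 * \sum_(j < M) \sum_(l < M) (X j w - mu) * (X l w - mu))%R.
  rewrite -big_distrlr/= -expr2 -exprMn; congr (_ ^+ 2)%R.
  rewrite sumrB sumr_const card_ord mulrBr; congr (_ - _)%R.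
  by rewrite mulrnAr -mulr_natr mulrAC mulVf ?mul1r// pnatr_eq0 -lt0n.
under eq_integral do rewrite expand EFinM -sumEFin.
under eq_integral => w _ do under [X in _ * X]eq_bigr do rewrite -sumEFin.
rewrite integralZl//; last first.
  by apply: integrable_sum => // j _; apply: integrable_sum.
rewrite integral_sum//; last by move=> j; apply: integrable_sum.
under eq_bigr => j _.
  rewrite integral_sum// (bigD1 j)//= big1 ?adde0; last first.
    by move=> l lj; rewrite uncorrelated// eq_sym.
  over.
apply: (@le_trans _ _ ((M%:R^-1 ^+ 2)%:E * \sum_(j < M) s%:E)).
  apply: lee_wpmul2l; first by rewrite lee_fin sqr_ge0.
  by apply: lee_sum => j _; exact: D2le.
rewrite sumEFin -!EFinM lee_fin sumr_const card_ord -[(s *+ M)%R]mulr_natr.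
rewrite (_ : _ * (s * _) = M%:R^-1 * s)%R//.
by field; rewrite pnatr_eq0 -lt0n.
Qed.

End sample_mean.

(** * Monte Carlo error of a single scalar coefficient *)

Section monte_carlo_component.
Context (dO dT dV : measure_display) (Omega : measurableType dO)
  (T : measurableType dT) (V : measurableType dV) (R : realType).
Variables (P : probability Omega R) (pi : probability T R)
  (nu : R.-pker T ~> V) (M : nat)
  (theta : 'I_M -> {RV P >-> T}) (v : 'I_M -> {RV P >-> V}).
Hypotheses (M0 : (0 < M)%N)
  (theta_law : forall j, has_law P (theta j) pi)
  (v_law : forall j, has_cond_law P (theta j) (v j) nu)
  (indep : mutually_independent P (fun j w => (theta j w, v j w))).
Variables (b : T -> R) (g : T * V -> R) (gbar : T -> R).
Hypotheses (mb : measurable_fun setT b) (mg : measurable_fun setT g)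
  (b2 : (\int[pi]_t (b t ^+ 2)%:E < +oo)%E)
  (g2 : (\int[pi]_t \int[nu t]_u (g (t, u) ^+ 2)%:E < +oo)%E)
  (g2t : forall t, (\int[nu t]_u (g (t, u) ^+ 2)%:E < +oo)%E)
  (gbarE : forall t, gbar t = \int[nu t]_u g (t, u)).

Let Z j w := (theta j w, v j w).
Let Y (z : T * V) := b z.1 * g z.
Let mu := \int[pi]_t (b t * gbar t).

Let mZ j : measurable_fun setT (Z j).
Proof. exact: measurable_fun_pair. Qed.

Let mY : measurable_fun setT Y.
Proof. by apply: measurable_funM => //; exact: measurableT_comp. Qed.

Let RVZ j : {RV P >-> (T * V)%type} :=
  MeasurableFun.Pack (MeasurableFun.Class
    (isMeasurableFun.Build _ _ _ _ _ (mZ j))).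

Let mYZ j : measurable_fun setT (fun w => Y (Z j w)).
Proof. exact: measurableT_comp mY (mZ j). Qed.

Let pairwise_indep j l : j != l -> forall A C, measurable A -> measurable C ->
  P (Z j @^-1` A `&` Z l @^-1` C) = (P (Z j @^-1` A) * P (Z l @^-1` C))%E.
Proof.
move=> jl A C mA mC.
(* Mutual independence for the index set [{j, l}], with event [A] at [j] and [C] at [l]. *)
have := indep [set j; l]%SET (fun i => if i == j then A else C).
have -> : \bigcap_(i in [set i | i \in [set j; l]%SET])
    Z i @^-1` (if i == j then A else C) = Z j @^-1` A `&` Z l @^-1` C.
  apply/seteqP; split => [w h|w [h1 h2] i /=].
    split; first by have := h j; rewrite /= !inE eqxx; exact.
    by have := h l; rewrite /= !inE eqxx orbT eq_sym (negbTE jl); exact.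
  by rewrite !inE; case: eqVneq => [->//|_ /= /eqP ->].
rewrite big_setU1/= ?inE// big_set1 eqxx eq_sym (negbTE jl); apply.
by move=> i; case: ifP.
Qed.

Local Open Scope ereal_scope.

Let lawZ j (phi : T * V -> \bar R) : measurable_fun setT phi ->
  (forall z, 0 <= phi z) ->
  \int[P]_w phi (Z j w) = \int[pi]_t \int[nu t]_u phi (t, u).
Proof. exact: cond_law_integral. Qed.

(** By disintegration both factors have finite second moments, so their product is integrable. *)
Let iY j : P.-integrable setT (fun w => (Y (Z j w))%:E).
Proof.
apply: (integrableM_sqr _ _ _ _ (fun w => b (theta j w)) (fun w => g (Z j w))).
- exact: measurableT_comp.
- exact: measurableT_comp.
- apply: integrable_sqr; first exact: measurableT_comp.
  rewrite (lawZ j (fun z => (b z.1 ^+ 2)%:E)); last 2 first.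
  + apply/measurable_EFinP; apply: measurable_funX; exact: measurableT_comp.
  + by move=> z; rewrite lee_fin sqr_ge0.
  under eq_integral.
    move=> t _; rewrite /= integral_cst// prob_kernel mule1; over.
  exact: b2.
- apply: integrable_sqr; first exact: measurableT_comp.
  rewrite (lawZ j (fun z => (g z ^+ 2)%:E))//.
  + by apply/measurable_EFinP; apply: measurable_funX.
  + by move=> z; rewrite lee_fin sqr_ge0.
Qed.

(** Disintegration is available for nonnegative functions, so [Y] is split into its positive and
    negative parts. Integrability allows them to be recombined, and for fixed [t] the factor [b t]
    leaves the inner integral, which becomes [gbar t]. *)
Let mean j : \int[P]_w (Y (Z j w))%:E = mu%:E.
Proof.
have mYE : measurable_fun setT (EFin \o Y) by exact/measurable_EFinP.
have fin (f : T * V -> \bar R) : measurable_fun setT f -> (forall z, 0 <= f z) ->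
    \int[P]_w f (Z j w) < +oo ->
    pi.-integrable setT (fun t => \int[nu t]_u f (t, u)).
  move=> mf f0 foo; apply/integrableP; split.
    exact: measurable_fun_integral_finite_kernel.
  under eq_integral do rewrite gee0_abs ?integral_ge0//.
  by rewrite -(lawZ j).
have E : \int[P]_w (Y (Z j w))%:E = \int[pi]_t (b t * gbar t)%:E.
  rewrite (integralE_comp _ _ _ _ _ (Z j) (EFin \o Y)).
  rewrite [X in X - _](lawZ j (EFin \o Y)^\+)//; last exact: measurable_funepos.
  rewrite [X in _ - X](lawZ j (EFin \o Y)^\-)//; last exact: measurable_funeneg.
  rewrite -integralB//; last 2 first.
  - apply: fin => //; first exact: measurable_funepos.
    have := integrable_funepos measurableT (iY j) => /integrableP[_].
    under eq_integral do rewrite gee0_abs// funeposE.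
    by under [X in _ -> X < _]eq_integral do rewrite funeposE.
  - apply: fin => //; first exact: measurable_funeneg.
    have := integrable_funeneg measurableT (iY j) => /integrableP[_].
    under eq_integral do rewrite gee0_abs// funenegE.
    by under [X in _ -> X < _]eq_integral do rewrite funenegE.
  apply: eq_integral => t _.
  have gi : (nu t).-integrable setT (fun u => (g (t, u))%:E).
    under eq_fun do rewrite -[g _]mulr1.
    have mgt : measurable_fun setT (fun u => g (t, u)) by exact: measurableT_comp.
    apply: (integrableM_sqr _ _ _ _ _ (cst 1%R)) => //.
      by apply: integrable_sqr => //; exact: g2t.
    apply: integrable_sqr => //.
    by rewrite /= integral_cst// prob_kernel mule1 ltry.
  transitivity (\int[nu t]_u (b t * g (t, u))%:E).
    by rewrite (integralE_comp _ _ _ _ _ (pair t) (EFin \o Y)).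
  under eq_integral do rewrite EFinM.
  by rewrite integralZl// EFinM gbarE /Rintegral fineK// integrable_fin_num.
by rewrite E /mu /Rintegral fineK// -E integrable_fin_num.
Qed.

Lemma monte_carlo_component_le :
  \int[P]_w ((M%:R^-1 * \sum_(j < M) b (theta j w) * g (theta j w, v j w)
              - \int[pi]_t (b t * gbar t)) ^+ 2)%:E
  <= (M%:R^-1)%:E * \int[pi]_t \int[nu t]_u ((b t * g (t, u)) ^+ 2)%:E.
Proof.
apply: (sample_mean_sqerror_le _ _ _ _ _ (fun j w => Y (Z j w))) => //.
- move=> j l jl.
  have mYmu : measurable_fun setT (fun z => Y z - mu)%R by exact: measurable_funB.
  have iYmu i : P.-integrable setT (fun w => (Y (Z i w) - mu)%:E).
    under eq_fun do rewrite EFinB.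
    apply: integrableB => //; exact: finite_measure_integrable_cst.
  (* Independence of distinct samples factors the covariance into two centred expectations, each
     zero. *)
  rewrite (independent_expectationM _ _ _ _ _ _ _ _ (RVZ j) (RVZ l)
    (pairwise_indep j l jl) (fun z => Y z - mu)%R (fun z => Y z - mu)%R)//;
    [|exact: iYmu|exact: iYmu].
  rewrite [X in X * _](_ : _ = 0) ?mul0e//.
  under eq_integral do rewrite EFinB.
  rewrite integralB//; [|exact: iY|exact: finite_measure_integrable_cst].
  rewrite [X in X - _](mean j) integral_cst//.
  rewrite [X in _ - _ * X](_ : _ = 1); last exact: probability_setT.
  by rewrite mule1 subee.
- move=> j; rewrite (lawZ j (fun z => (Y z ^+ 2)%:E))//.
  + by apply/measurable_EFinP; exact: measurable_funX.
  + by move=> z; rewrite lee_fin sqr_ge0.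
Qed.

End monte_carlo_component.

(** * Summation over vector components and basis functions *)

Section monte_carlo.
Context (dO dT dV : measure_display) (Omega : measurableType dO)
  (T : measurableType dT) (V : measurableType dV) (R : realType).
Variables (P : probability Omega R) (pi : probability T R)
  (nu : R.-pker T ~> V) (M : nat)
  (theta : 'I_M -> {RV P >-> T}) (v : 'I_M -> {RV P >-> V}).
Hypotheses (M0 : (0 < M)%N)
  (theta_law : forall j, has_law P (theta j) pi)
  (v_law : forall j, has_cond_law P (theta j) (v j) nu)
  (indep : mutually_independent P (fun j w => (theta j w, v j w))).
Variables (q : nat) (B : nat -> T -> R) (g : 'I_q -> T * V -> R)
  (gbar : 'I_q -> T -> R) (W : T -> R).
Hypotheses (mB : forall i, measurable_fun setT (B i))
  (mg : forall c, measurable_fun setT (g c)) (mW : measurable_fun setT W)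
  (B2 : forall i, (\int[pi]_t (B i t ^+ 2)%:E < +oo)%E)
  (gbarE : forall c t, gbar c t = \int[nu t]_u g c (t, u))
  (gW : forall t, (\int[nu t]_u (\sum_(c < q) g c (t, u) ^+ 2)%:E <= (W t)%:E)%E)
  (iW : (\int[pi]_t (W t)%:E < +oo)%E).

Local Open Scope ereal_scope.

Let J c t := \int[nu t]_u (g c (t, u) ^+ 2)%:E.

Let mg2 c : measurable_fun setT (fun z => (g c z ^+ 2)%:E).
Proof. by apply/measurable_EFinP; exact: measurable_funX. Qed.

Let J0 c t : 0 <= J c t.
Proof. by apply: integral_ge0 => u _; rewrite lee_fin sqr_ge0. Qed.

Let mJ c : measurable_fun setT (J c).
Proof.
apply: (measurable_fun_integral_finite_kernel (fun z => (g c z ^+ 2)%:E)) => // z.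
by rewrite lee_fin sqr_ge0.
Qed.

Let JW t : \sum_(c < q) J c t <= (W t)%:E.
Proof.
apply: le_trans (gW t); under [leRHS]eq_integral do rewrite -sumEFin.
rewrite ge0_integral_sum// => [c|c u _]; last by rewrite lee_fin sqr_ge0.
exact: (measurableT_comp (mg2 c)).
Qed.

Let J_le c t : J c t <= (W t)%:E.
Proof.
by apply: le_trans (JW t); rewrite (bigD1 c)//= leeDl// sume_ge0.
Qed.

Let W0 t : 0 <= (W t)%:E.
Proof. by apply: le_trans (JW t); rewrite sume_ge0. Qed.

Let supsq_ge m t : (\sum_(i < m) B i t ^+ 2)%:E <= supsq B m.
Proof.
apply: ereal_sup_ubound; exists t => //; congr (_%:E).
by apply: eq_bigr => i _; rewrite real_normK ?num_real.
Qed.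

Let supsq0 m : 0 <= supsq B m.
Proof.
by apply: le_trans (supsq_ge m point); rewrite lee_fin sumr_ge0// => i _; rewrite sqr_ge0.
Qed.

Let err i c w : R := (M%:R^-1 * \sum_(j < M) B i (theta j w) * g c (theta j w, v j w)
  - \int[pi]_t (B i t * gbar c t))%R.

Let merr i c : measurable_fun setT (fun w => (err i c w ^+ 2)%:E).
Proof.
apply/measurable_EFinP; apply: measurable_funX; apply: measurable_funB => //.
apply: measurable_funM => //; apply: measurable_sum => j.
apply: measurable_funM; first exact: measurableT_comp.
by apply: (measurableT_comp (mg c)); exact: measurable_fun_pair.
Qed.

(** The component bounds are summed under the integral, where the double sum factors into the sum of
    the [B i t ^+ 2] and the sum of the [J c t]: the former is at most the supremum, the latter at
    most [W t]. *)
Lemma monte_carlo_sqerror_le m :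
  \sum_(i < m) \int[P]_w (\sum_(c < q) (M%:R^-1 *
      \sum_(j < M) B i (theta j w) * g c (theta j w, v j w)
      - \int[pi]_t (B i t * gbar c t)) ^+ 2)%:E
  <= supsq B m * (M%:R^-1)%:E * \int[pi]_t (W t)%:E.
Proof.
have Mp : (0 <= M%:R^-1 :> R)%R by rewrite invr_ge0 ler0n.
apply: (@le_trans _ _ (\sum_(i < m) \sum_(c < q)
    (M%:R^-1)%:E * \int[pi]_t ((B i t ^+ 2)%:E * J c t))).
  apply: lee_sum => i _.
  under eq_integral do rewrite -sumEFin.
  rewrite ge0_integral_sum//; last 2 first.
  - by move=> c; exact: merr.
  - by move=> c w _; rewrite lee_fin sqr_ge0.
  apply: lee_sum => c _.
  apply: le_trans (monte_carlo_component_le _ _ _ _ _ _ _ _ pi nu _ _ _ M0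
    theta_law v_law indep _ _ _ (mB i) (mg c) (B2 i) _ _ (gbarE c)) _.
  (* The finiteness conditions of the component bound follow from the domination of [J c] by [W]. *)
  - apply: le_lt_trans iW; rewrite -[leLHS]/(\int[pi]_t J c t).
    by apply: ge0_le_integral => //; exact/measurable_EFinP.
  - by move=> t; apply: le_lt_trans (J_le c t) _; rewrite ltry.
  apply: lee_wpmul2l; first by rewrite lee_fin.
  apply: ge0_le_integral => //.
  - by move=> t _; apply: integral_ge0 => u _; rewrite lee_fin sqr_ge0.
  - apply: (measurable_fun_integral_finite_kernel
      (fun z => ((B i z.1 * g c z) ^+ 2)%:E)) => [z|].
      by rewrite lee_fin sqr_ge0.
    apply/measurable_EFinP; apply: measurable_funX; apply: measurable_funM => //.
    exact: measurableT_comp.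
  - apply: emeasurable_funM => //; apply/measurable_EFinP; exact: measurable_funX.
  - move=> t _; under eq_integral do rewrite exprMn EFinM.
    rewrite ge0_integralZl//.
    + exact: (measurableT_comp (mg2 c)).
    + by move=> u _; rewrite lee_fin sqr_ge0.
    + by rewrite lee_fin sqr_ge0.
have mBJ i c : measurable_fun setT (fun t => (B i t ^+ 2)%:E * J c t).
  by apply: emeasurable_funM => //; apply/measurable_EFinP; exact: measurable_funX.
have BJ0 i c t : 0 <= (B i t ^+ 2)%:E * J c t by rewrite mule_ge0// lee_fin sqr_ge0.
rewrite [leLHS](_ : _ = (M%:R^-1)%:E *
    \int[pi]_t \sum_(i < m) \sum_(c < q) ((B i t ^+ 2)%:E * J c t)); last first.
  rewrite ge0_integral_sum//; last 2 first.
  - by move=> i; apply: emeasurable_sum => c; exact: mBJ.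
  - by move=> i t _; exact: sume_ge0.
  rewrite ge0_sume_distrr; last first.
    by move=> i _; apply: integral_ge0 => t _; exact: sume_ge0.
  apply: eq_bigr => i _; rewrite ge0_integral_sum// ge0_sume_distrr//.
  by move=> c _; exact: integral_ge0.
rewrite [supsq B m * _]muleC -muleA; apply: lee_wpmul2l; first by rewrite lee_fin.
(* [supsq B m] may be [+oo]: it enters the integral as a nonnegative extended constant, and the
   comparison is made pointwise in [t]. *)
rewrite -ge0_integralZl//; last exact/measurable_EFinP.
apply: ge0_le_integral => //.
- by move=> t _; do 2 apply: sume_ge0 => ? _.
- by apply: emeasurable_sum => i; apply: emeasurable_sum => c; exact: mBJ.
- by apply: measurable_funeM; exact/measurable_EFinP.
- move=> t _.
  rewrite [leLHS](_ : _ = (\sum_(i < m) B i t ^+ 2)%:E * \sum_(c < q) J c t).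
    apply: lee_pmul => //; last exact: sume_ge0.
    by rewrite lee_fin sumr_ge0// => i _; rewrite sqr_ge0.
  rewrite -sumEFin ge0_sume_distrl; last by move=> i _; rewrite lee_fin sqr_ge0.
  by apply: eq_bigr => i _; rewrite ge0_sume_distrr.
Qed.

End monte_carlo.

Lemma norm2_sqr (R : realType) (m n : nat) (A : 'M[R]_(m, n)) :
  norm2 A ^+ 2 = \sum_(i < m) \sum_(j < n) A i j ^+ 2.
Proof.
by rewrite sqr_sqrtr// !sumr_ge0// => i _; rewrite sumr_ge0// => j _; rewrite sqr_ge0.
Qed.

(** * Joint measurability of the two gradients *)

Section measurable_gradients.
Context (dT dV : measure_display) (T : measurableType dT)
  (V : measurableType dV) (R : realType) (q : nat).
Variables (nu : R.-pker T ~> V) (F : 'rV[R]_q -> T -> V -> R) (c : 'I_q).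
Hypothesis mF : measurable_fun setT
  (fun p : 'rV[R]_q * T * V => F p.1.1 p.1.2 p.2).

Lemma measurable_grad_F :
  (forall (y : 'rV[R]_q) t v, differentiable (fun z => F z t v) y) ->
  measurable_fun setT
    (fun p : 'rV[R]_q * (T * V) => grad_F F p.1 p.2.1 p.2.2 ord0 c).
Proof.
move=> dF.
apply: (measurable_grad _ _ _ _ (fun y (s : T * V) => F y s.1 s.2)) => //.
apply: (measurableT_comp mF (g := fun p : 'rV[R]_q * (T * V) =>
  ((p.1, p.2.1), p.2.2))).
apply: measurable_fun_pair; last exact: measurableT_comp.
by apply: measurable_fun_pair => //; exact: measurableT_comp.
Qed.

Lemma measurable_grad_f :
  (forall (y : 'rV[R]_q) t, differentiable (fun z => mean_obj nu F z t) y) ->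
  measurable_fun setT (fun p : 'rV[R]_q * T => grad_f nu F p.1 p.2 ord0 c).
Proof.
move=> df; apply: (measurable_grad _ _ _ _ (mean_obj nu F)) => //.
(* [kernel_snd] makes [nu] a kernel from pairs [(y, t)] that depends on [t] alone, so the mean
   objective is an integral with parameter [(y, t)]. *)
exact: (measurable_Rintegral_kernel _ _ _ _ _
  (kernel.kernel_snd nu : R.-fker ('rV[R]_q * T)%type ~> V) _ mF).
Qed.

End measurable_gradients.

(** * Conditioning on the past and conclusion *)

Theorem theorem3p2 (R : realType) (d q : nat) (hq : (0 < q)%N)
  (Theta : set 'rV[R]_d) (ne : Theta !=set0)
  (pi : probability (subset_space ne) R)
  (B : nat -> subset_space ne -> R) (hB : orthonormal_basis pi B)
  (dV : measure_display) (V : measurableType dV)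
  (nu : R.-pker (subset_space ne) ~> V)
  (F : 'rV[R]_q -> subset_space ne -> V -> R)
  (mF : measurable_fun setT
     (fun p : 'rV[R]_q * subset_space ne * V => F p.1.1 p.1.2 p.2))
  (iF : forall y t, (nu t).-integrable setT (fun v => (F y t v)%:E))
  (dF : forall (y : 'rV[R]_q) t v, differentiable (fun z => F z t v) y)
  (df : forall (y : 'rV[R]_q) t, differentiable (fun z => mean_obj nu F z t) y)
  (unbiased : forall x : subset_space ne -> 'rV[R]_q, L2 pi x ->
     forall t, grad_f nu F (x t) t = vintegral (nu t) (fun v => grad_F F (x t) t v))
  (gradL2 : forall x : subset_space ne -> 'rV[R]_q, L2 pi x ->
     L2 pi (fun t => grad_f nu F (x t) t))
  (Vc VG : R) (hVc : 0 <= Vc) (hVG : 1 <= VG)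
  (hvar : forall t x, L2 pi x ->
     (\int[nu t]_v ((norm2 (grad_F F (x t) t v)) ^+ 2)%:E
        <= (Vc + VG * norm2 (grad_f nu F (x t) t) ^+ 2)%:E)%E)
  (dO : measure_display) (Omega : measurableType dO) (P : probability Omega R)
  (k : nat) (hk : (0 < k)%N)
  (dU : nat -> measure_display) (U : forall l, measurableType (dU l))
  (xi : forall l, {RV P >-> U l})
  (xk : Omega -> subset_space ne -> 'rV[R]_q)
  (xk_adapted : measurable_fun setT
     (fun p : g_sigma_algebraType (history (fun l => xi l) k.-1)
              * subset_space ne => xk p.1 p.2))
  (xkL2 : forall w, L2 pi (xk w))
  (mk Mk : nat) (hMk : (0 < Mk)%N)
  (theta : 'I_Mk -> {RV P >-> subset_space ne}) (v : 'I_Mk -> {RV P >-> V})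
  (theta_law : forall j, has_law P (theta j) pi)
  (v_law : forall j, has_cond_law P (theta j) (v j) nu)
  (samples_indep : mutually_independent P (fun j w => (theta j w, v j w)))
  (past_indep : sigma_independent P (history (fun l => xi l) k.-1)
     (\bigcup_j preimage_set_system setT
        (fun w => (theta j w, v j w)) measurable)) :
  let G := history (fun l => xi l) k.-1 in
  let e := fun w => mc_error nu F pi B mk (xk w)
                      (fun j => theta j w) (fun j => v j w) in
  {ae P, forall w,
     condexp P G (fun w' => (norm2 (e w') ^+ 2)%:E) w
       = (\sum_(i < mk) condexp P G (fun w' => (norm2 (row i (e w')) ^+ 2)%:E) w)%E
     /\ (\sum_(i < mk) condexp P G (fun w' => (norm2 (row i (e w')) ^+ 2)%:E) w
       <= supsq B mk * (Mk%:R^-1)%:E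
          * (VG%:E * L2sqnorm pi (fun t => grad_f nu F (xk w t) t) + Vc%:E))%E}.
Proof.
move=> G e.
pose Z j w := (theta j w, v j w).
pose H : set_system Omega := \bigcup_j preimage_set_system setT (Z j) measurable.
have Gm : G `<=` measurable.
  by move=> _ [l _ [A mA <-]]; exact: measurable_funP.
have Hm : H `<=` measurable.
  by move=> _ [j _ [A mA <-]]; apply: measurable_fun_pair.
have mZ j : measurable_fun setT (Z j : g_sigma_algebraType H -> _).
  move=> _ A mA; apply: sub_sigma_algebra.
  by exists j => //; exists A.
have mB i : measurable_fun setT (B i).
  by have [+ _ _] := hB => /(_ i); rewrite inE => /andP[+ _]; rewrite inE.
have B2 i : (\int[pi]_t (B i t ^+ 2)%:E < +oo)%E.
  have [+ _ _] := hB => /(_ i) /Lfun2_integrable_sqr/integrableP[_].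
  by under eq_integral do rewrite /= ger0_norm ?sqr_ge0//.
pose gF (x : subset_space ne -> 'rV[R]_q) c (z : subset_space ne * V) :=
  grad_F F (x z.1) z.1 z.2 ord0 c.
pose gf (x : subset_space ne -> 'rV[R]_q) c t := grad_f nu F (x t) t ord0 c.
(* The two roles of the outcome are separated: [z.1] determines the iterate and [z.2] the samples.
   The actual error is the restriction to the diagonal. *)
pose err i c (z : g_sigma_algebraType G * g_sigma_algebraType H) : R :=
  Mk%:R^-1 * \sum_(j < Mk) B i (theta j z.2) * gF (xk z.1) c (Z j z.2)
  - \int[pi]_t (B i t * gf (xk z.1) c t).
have merr i c : measurable_fun setT (err i c).
  apply: measurable_funB.
    apply: measurable_funM => //; apply: measurable_sum => j.
    have mZj : measurable_fun setT
        (fun z : g_sigma_algebraType G * g_sigma_algebraType H => Z j z.2).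
      exact: measurableT_comp (mZ j) measurable_snd.
    have mtheta := measurableT_comp measurable_fst mZj.
    apply: measurable_funM; first exact: measurableT_comp (mB i) mtheta.
    have mxk := measurableT_comp xk_adapted (measurable_fun_pair measurable_fst mtheta).
    exact: (measurableT_comp (measurable_grad_F _ _ _ _ _ _ F c mF dF)
      (measurable_fun_pair mxk mZj)).
  (* As a constant kernel, [pi] makes the exact coefficient a parametric integral, measurable in the
     past. *)
  pose l : R.-pker (g_sigma_algebraType G) ~> subset_space ne :=
    kprobability (@measurable_cst _ _ (g_sigma_algebraType G)
      (pprobability (subset_space ne) R) setT pi).
  apply: (measurableT_comp (measurable_Rintegral_kernel _ _ _ _ _ l
    (fun z => B i z.2 * gf (xk z.1) c z.2) _) measurable_fst).
  apply: measurable_funM; first exact: measurableT_comp (mB i) measurable_snd.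
  exact: (measurableT_comp (measurable_grad_f _ _ _ _ _ _ nu F c mF df)
    (measurable_fun_pair xk_adapted measurable_snd)).
have eE w i c : e w i c = err i c (w, w).
  rewrite !mxE summxE /err; congr (_ * _ - _).
    by apply: eq_bigr => j _; rewrite mxE.
  by apply: eq_Rintegral => t _; rewrite mxE.
pose Phi i z : \bar R := (\sum_(c < q) err i c z ^+ 2)%:E.
have mPhi i : measurable_fun setT (Phi i).
  by apply/measurable_EFinP; apply: measurable_sum => c; exact: measurable_funX.
have Phi0 i z : (0 <= Phi i z)%E.
  by rewrite lee_fin sumr_ge0// => c _; rewrite sqr_ge0.
have rowE (i : 'I_mk) : (fun w => (norm2 (row i (e w)) ^+ 2)%:E) = fun w => Phi i (w, w).
  apply/funext => w; rewrite norm2_sqr big_ord1; congr (_%:E).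
  by apply: eq_bigr => c _; rewrite mxE eE.
have allE : (fun w => (norm2 (e w) ^+ 2)%:E) = fun w => (\sum_(i < mk) Phi i (w, w))%E.
  apply/funext => w; rewrite norm2_sqr -sumEFin; apply: eq_bigr => i _; congr (_%:E).
  by apply: eq_bigr => c _; rewrite eE.
(* Freezing: integrating out the sample variable alone gives a version of the conditional
   expectation, for each row and then for the sum of rows. *)
have rowC := condexp_ae _ _ _ P G Gm _ _
  (is_condexp_independent _ _ _ P G H _ Gm Hm past_indep (mPhi _) (Phi0 _)).
have mPhis : measurable_fun setT (fun z => \sum_(i < mk) Phi i z)%E.
  exact: emeasurable_sum.
have Phis0 z : (0 <= \sum_(i < mk) Phi i z)%E by exact: sume_ge0.
have allC := condexp_ae _ _ _ P G Gm _ _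
  (is_condexp_independent _ _ _ P G H _ Gm Hm past_indep mPhis Phis0).
(* The exceptional null sets of the finitely many rows are merged into one. *)
have : {ae P, forall w, forall i : 'I_mk,
    condexp P G (fun w' => Phi i (w', w')) w = (\int[P]_w' Phi i (w, w'))%E}.
  by apply: filter_forall => i; exact: rowC.
rewrite allE; apply: filterS2 allC => w allCw rowCw.
under eq_bigr do rewrite rowE rowCw.
split.
  (* Both sides are now ordinary integrals in [w'], so the equality is additivity of the
     integral. *)
  rewrite allCw ge0_integral_sum// => i.
  have := measurable_fun_pair2 (w : g_sigma_algebraType G) (mPhi i).
  exact: (measurable_fun_gen _ _ _ Hm).
(* From here [w] is fixed and the iterate deterministic. [W] is the assumed bound on the conditional
   second moment along [x]; since [pi] has mass one, its integral is the last factor of the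
   claim. *)
pose x := xk w.
pose W t := Vc + VG * norm2 (grad_f nu F (x t) t) ^+ 2.
have [mgf gfoo] := gradL2 x (xkL2 w).
have mN : measurable_fun setT (fun t => norm2 (grad_f nu F (x t) t) ^+ 2).
  under eq_fun do rewrite norm2_sqr big_ord1.
  apply: measurable_sum => c; apply: measurable_funX.
  exact: ((measurable_fun_rVP _ _ _ _ _).1 mgf).
have mW : measurable_fun setT W.
  by apply: measurable_funD => //; exact: measurable_funM.
have WE : (\int[pi]_t (W t)%:E =
    VG%:E * L2sqnorm pi (fun t => grad_f nu F (x t) t) + Vc%:E)%E.
  have VG0 : 0 <= VG by exact: le_trans hVG.
  rewrite /W; under eq_integral do rewrite EFinD EFinM.
  rewrite ge0_integralD//; last 2 first.
  - by move=> t _; rewrite mule_ge0// lee_fin sqr_ge0.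
  - by apply: measurable_funeM; exact/measurable_EFinP.
  rewrite ge0_integralZl//; last 2 first.
  - exact/measurable_EFinP.
  - by move=> t _; rewrite lee_fin sqr_ge0.
  rewrite addeC integral_cst//.
  rewrite [X in (_ + _ * X)%E](_ : _ = 1%E); last exact: probability_setT.
  by rewrite mule1.
rewrite -WE.
apply: (monte_carlo_sqerror_le _ _ _ _ _ _ _ P pi nu _ _ _ hMk theta_law v_law
  samples_indep _ B (gF x) (gf x)) => //.
- have [mx _] := xkL2 w; move=> c.
  have mxz : measurable_fun setT (fun z : subset_space ne * V => (x z.1, z)).
    apply: measurable_fun_pair => //; exact: measurableT_comp mx measurable_fst.
  exact: measurableT_comp (measurable_grad_F _ _ _ _ _ _ F c mF dF) mxz.
- by move=> c t; rewrite /gf (unbiased _ (xkL2 w)) /vintegral mxE.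
- move=> t; apply: le_trans (hvar t x (xkL2 w)).
  by under [leRHS]eq_integral do rewrite norm2_sqr big_ord1.
(* Finiteness comes from the square-integrability of the gradient along [x]. *)
- rewrite WE; apply: lte_add_pinfty; last by rewrite ltry.
  by apply: lte_mul_pinfty => //; rewrite lee_fin (le_trans _ hVG).
Qed.
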